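(* For every $\varepsilon>0$ there exists $\delta>0$ such that the following holds. If $G$ is a triangle-free graph with $n$ vertices and at least $\left(\frac15-\delta\right)n^2$ edges, then either (i) $G$ can be $\varepsilon$-approximated by $C_5$, or (ii) at least $\delta n$ vertices of $G$ have degree at least $\left(\frac25+\delta\right)n$, or (iii) there exists $F\subseteq E(G)$ with $|F|\le\varepsilon n^2$ such that $G-F$ is bipartite.
   Context: With $V(C_5)=\{1,\dots,5\}$, a graph $G$ of order $n$ can be $\varepsilon$-approximated by $C_5$ if there is a partition $V(G)=V_1\cup\dots\cup V_5$ with $||V_i|-n/5|\le\varepsilon n$ for all $i$ and $|E(G)\triangle E(H_{\mathcal V})|\le\varepsilon n^2$, where $H_{\mathcal V}$ is the graph on $V(G)$ with each $V_i$ independent, $V_i,V_j$ completely joined if $ij\in E(C_5)$ and with no edges between them otherwise. *)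

(* Defs.v *)
From mathcomp Require Import all_boot all_order all_algebra.
From mathcomp Require Import reals.
Set Implicit Arguments.
Unset Strict Implicit.
Unset Printing Implicit Defensive.

Import Order.TTheory GRing.Theory Num.Theory.
Local Open Scope ring_scope.

Record sgraph (T : finType) := SGraph {
  adj :> rel T;
  adj_sym : symmetric adj;
  adj_irrefl : irreflexive adj
}.

Section Graphs.
Variable T : finType.
Implicit Types (G : sgraph T) (F : {set {set T}}).

Definition edges G : {set {set T}} := [set [set p.1; p.2] | p : T * T & G p.1 p.2].

Definition degree G (x : T) : nat := #|[set y | G x y]|.

Definition triangle_free G : Prop :=
  forall x y z : T, ~ [/\ G x y, G y z & G z x].

Definition bipartite G : Prop :=
  exists A : {set T}, forall x y : T, G x y -> (x \in A) != (y \in A).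

Definition del_edges_rel G F : rel T :=
  fun x y => G x y && ([set x; y] \notin F).

Lemma del_edges_sym G F : symmetric (del_edges_rel G F).
Proof. by move=> x y; rewrite /del_edges_rel adj_sym setUC. Qed.

Lemma del_edges_irrefl G F : irreflexive (del_edges_rel G F).
Proof. by move=> x; rewrite /del_edges_rel adj_irrefl. Qed.

Definition del_edges G F : sgraph T :=
  SGraph (del_edges_sym G F) (del_edges_irrefl G F).

End Graphs.

Definition C5_rel : rel 'I_5 := fun i j => (j == ordS i) || (i == ordS j).

Lemma C5_sym : symmetric C5_rel.
Proof. by move=> i j; rewrite /C5_rel orbC. Qed.

Lemma C5_irrefl : irreflexive C5_rel.
Proof. by case=> [[|[|[|[|[|i]]]]] Hi]. Qed.

Definition C5 : sgraph 'I_5 := SGraph C5_sym C5_irrefl.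

Section Blowup.
Variables (T U : finType) (H : sgraph U) (c : {ffun T -> U}).

(* A partition of T indexed by U is given by the map c sending a vertex to
   the index of its part; parts may be empty. *)
Definition part (i : U) : {set T} := [set x | c x == i].

Definition blowup_rel : rel T := fun x y => H (c x) (c y).

Lemma blowup_sym : symmetric blowup_rel.
Proof. by move=> x y; rewrite /blowup_rel adj_sym. Qed.

(* This also makes each part independent, as adjacency in H is irreflexive. *)
Lemma blowup_irrefl : irreflexive blowup_rel.
Proof. by move=> x; rewrite /blowup_rel adj_irrefl. Qed.

Definition blowup : sgraph T := SGraph blowup_sym blowup_irrefl.

End Blowup.

Definition symdiff (T : finType) (A B : {set T}) : {set T} :=
  (A :\: B) :|: (B :\: A).

Definition C5_approx (R : realType) (eps : R) (T : finType) (G : sgraph T) : Prop :=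
  exists c : {ffun T -> 'I_5},
    (forall i : 'I_5, `| #|part c i|%:R - #|T|%:R / 5 | <= eps * #|T|%:R) /\
    #|symdiff (edges G) (edges (blowup C5 c))|%:R <= eps * #|T|%:R ^+ 2.

(* Main.v *)
Require Import Defs.
From mathcomp Require Import all_boot all_order all_algebra.
From mathcomp Require Import reals.
From mathcomp Require Import zify lra.
Set Implicit Arguments.
Unset Strict Implicit.
Unset Printing Implicit Defensive.

Import Order.TTheory GRing.Theory Num.Theory.
Local Open Scope ring_scope.

(** If (ii) fails, then the edge count forces all but few vertices to have degree
    at least [(2/5 - gam) n]; let [S] be the set of these vertices.

    If [S] contains no closed walk of length 5, then having a common neighbour in
    [S] is a transitive relation on [S] with at most two classes, because three
    vertices of [S] cannot have pairwise disjoint neighbourhoods.  Adjacent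
    vertices lie in different classes, so removing the edges that leave [S] makes
    [G] bipartite.

    Otherwise take a 5-cycle [c] in [S].  Every vertex has at most two neighbours
    on it, and by the degrees of the [c i] all but few vertices have exactly two,
    say [c (i - 1)] and [c (i + 1)]; such a vertex goes to the part [i].
    Triangle-freeness then confines the edges between these vertices to consecutive
    parts, the degrees of the [c i] force all parts to have size about [n / 5], and
    the edge count shows that few edges of the blow-up are missing. *)

(** * Edge counting *)

Section Counting.
Variable T : finType.
Implicit Types (G H : sgraph T) (A S : {set T}).

Definition nbhd G x : {set T} := [set y | G x y].

Lemma mem_edges G x y : G x y -> [set x; y] \in edges G.
Proof. by move=> Gxy; apply/imsetP; exists (x, y); rewrite ?inE. Qed.

Lemma edgesP G e :
  reflect (exists x y, G x y /\ e = [set x; y]) (e \in edges G).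
Proof.
apply: (iffP imsetP) => [[[x y]] | [x [y [Gxy ->]]]]; last first.
  by exists (x, y); rewrite ?inE.
by rewrite inE /= => Gxy ->; exists x, y.
Qed.

Lemma double_card_edges_le G : (2 * #|edges G| <= \sum_x degree G x)%N.
Proof.
pose D := [set p : T * T | G p.1 p.2].
have -> : (\sum_x degree G x)%N = #|D|.
  rewrite -sum1_card (eq_bigl (fun p : T * T => true && G p.1 p.2)); last first.
    by move=> p; rewrite inE.
  rewrite -(pair_big_dep xpredT (fun x y => G x y) (fun _ _ => 1%N)) /=.
  by apply: eq_bigr => x _; rewrite sum1dep_card.
rewrite -[leqRHS]sum1_card (partition_big_imset (fun p : T * T => [set p.1; p.2])) /=.
have -> : [set [set p.1; p.2] | p in D] = edges G by apply: eq_imset.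
rewrite mulnC -sum_nat_const; apply: leq_sum => e /edgesP[x [y [Gxy ->]]].
rewrite sum1dep_card.
have xy : x != y by apply: contraTneq Gxy => ->; rewrite adj_irrefl.
have <- : #|[set (x, y); (y, x)]| = 2%N by rewrite cards2 xpair_eqE (negbTE xy).
apply/subset_leq_card/subsetP => p; rewrite !inE.
case/orP=> /eqP-> /=; first by rewrite Gxy eqxx.
by rewrite adj_sym Gxy setUC eqxx.
Qed.

Lemma degree_sum G x : degree G x = (\sum_y G y x)%N.
Proof.
rewrite /degree -sum1dep_card big_mkcond; apply: eq_bigr => y _.
by rewrite adj_sym; case: ifP.
Qed.

Definition incident_edges G A : {set {set T}} :=
  [set e in edges G | e :&: A != set0].

Lemma incident_edgesP G A x y :
  G x y -> ([set x; y] \in incident_edges G A) = (x \in A) || (y \in A).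
Proof.
move=> Gxy; rewrite inE mem_edges //=; apply/set0Pn/orP.
  by case=> z; rewrite !inE => /andP[/orP[]/eqP-> zA]; [left | right].
by case=> zA; [exists x | exists y]; rewrite !inE eqxx zA ?orbT.
Qed.

Lemma card_incident_edges G A : (#|incident_edges G A| <= #|A| * #|T|)%N.
Proof.
rewrite -cardsT -cardsX.
apply: leq_trans (leq_imset_card (fun p : T * T => [set p.1; p.2]) _).
apply/subset_leq_card/subsetP => e eA.
have /edgesP[x [y [Gxy def_e]]] : e \in edges G by move: eA; rewrite inE => /andP[].
move: eA; rewrite {}def_e incident_edgesP // => /orP[] zA; apply/imsetP.
  by exists (x, y); rewrite ?inE ?zA.
by exists (y, x); rewrite ?inE ?zA //= setUC.
Qed.

(** The symmetric difference has size [|E(H)| - |E(G)| + 2 |E(G) \ E(H)|], and every edge of [G]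
    outside [H] meets [A]. *)
Lemma card_symdiff_edges G H A :
    (forall x y, G x y -> x \notin A -> y \notin A -> H x y) ->
  (#|symdiff (edges G) (edges H)| + #|edges G|
     <= #|edges H| + 2 * (#|A| * #|T|))%N.
Proof.
move=> GH.
have : (#|edges G :\: edges H| <= #|A| * #|T|)%N.
  apply: leq_trans (card_incident_edges G A).
  apply/subset_leq_card/subsetP => e /setDP[/edgesP[x [y [Gxy ->]]]].
  apply: contraR; rewrite incident_edgesP // negb_or => /andP[xA yA].
  exact/mem_edges/GH.
have [+ _] := leq_card_setU (edges G :\: edges H) (edges H :\: edges G).
move: (cardsID (edges H) (edges G)) (cardsID (edges G) (edges H)).
rewrite -/(symdiff _ _) [edges H :&: _]setIC.
lia.
Qed.

End Counting.

(** * Two-colouring in the absence of closed walks of length 5 *)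

Section TwoColouring.
Variables (T : finType) (G : sgraph T) (S : {set T}).
Hypothesis tfG : triangle_free G.
Hypothesis large_nbhd : forall x, x \in S -> (#|T| < 3 * #|nbhd G x :&: S|)%N.
Hypothesis no_walk5 : forall a b c d e, a \in S -> b \in S -> c \in S -> d \in S ->
  e \in S -> ~ [/\ G a b, G b c, G c d, G d e & G e a].

Let twins x y := [exists z in S, G x z && G y z].

Let twinsP x y : reflect (exists z, [/\ z \in S, G x z & G y z]) (twins x y).
Proof.
apply: (iffP exists_inP) => [[z zS /andP[xz yz]] | [z [zS xz yz]]].
  by exists z.
by exists z => //; rewrite xz yz.
Qed.

Let twins_sym x y : twins x y = twins y x.
Proof. by apply/twinsP/twinsP => -[z [zS xz yz]]; exists z. Qed.

Let twins_disjoint x y : ~~ twins x y -> [disjoint nbhd G x :&: S & nbhd G y :&: S].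
Proof.
move=> nxy; apply/pred0P => z; apply: contraNF nxy; rewrite !inE.
by move=> /andP[/andP[xz zS] /andP[yz _]]; apply/twinsP; exists z.
Qed.

Let twins_of_three x y z : x \in S -> y \in S -> z \in S ->
  [|| twins x y, twins y z | twins x z].
Proof.
move=> xS yS zS; apply/negPn/negP; rewrite !negb_or => /and3P[xy yz xz].
have := large_nbhd xS; have := large_nbhd yS; have := large_nbhd zS.
have := max_card (mem ((nbhd G x :&: S) :|: (nbhd G y :&: S) :|: (nbhd G z :&: S))).
have := twins_disjoint xy; have := twins_disjoint yz; have := twins_disjoint xz.
move=> /disjoint_setI0 xz0 /disjoint_setI0 yz0 /disjoint_setI0 xy0.
rewrite !cardsU setIUl xz0 yz0 xy0 setU0 cards0.
lia.
Qed.

Let twinsN_adj x y : G x y -> ~~ twins x y.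
Proof.
move=> xy; apply/twinsP => -[z [_ xz yz]].
by apply: (tfG (x := x) (y := y) (z := z)); split; rewrite // adj_sym.
Qed.

(* If a and b witness x ~ y and y ~ z, then the neighbourhood of a misses those
   of x and z, so x and z must be twins. *)
Let twins_trans x y z : x \in S -> y \in S -> z \in S ->
  twins x y -> twins y z -> twins x z.
Proof.
move=> xS yS zS /twinsP[a [aS xa ya]] /twinsP[b [bS yb zb]].
have [||] := or3P (twins_of_three xS aS zS) => //.
  by rewrite (negbTE (twinsN_adj xa)).
(* A common neighbour [w] of [a] and [z] would close the walk [w a y b z]. *)
case/twinsP=> w [wS aw zw].
by case: (no_walk5 wS aS yS bS zS); split; rewrite // adj_sym.
Qed.

(** The colour classes are the twins of a fixed [x0] and the rest. Two vertices of the same class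
    are twins, by transitivity or by [twins_of_three] with [x0], hence not adjacent. *)
Lemma two_colouring_of_no_walk5 :
  exists A : {set T}, forall x y, x \in S -> y \in S -> G x y ->
    (x \in A) != (y \in A).
Proof.
have [-> | [x0 x0S]] := set_0Vmem S; first by exists set0 => x y; rewrite inE.
exists [set x | twins x0 x] => x y xS yS xy; rewrite !inE.
have nxy := twinsN_adj xy.
have := twins_of_three x0S xS yS; rewrite (negbTE nxy) /=.
case x0x: (twins x0 x); case x0y: (twins x0 y) => //= _.
by case/negP: nxy; apply: (twins_trans xS x0S yS); rewrite // twins_sym.
Qed.

End TwoColouring.

(** * Index arithmetic modulo 5 *)

Lemma ord5_ind (P : 'I_5 -> Prop) :
  P (inord 0) -> P (inord 1) -> P (inord 2) -> P (inord 3) -> P (inord 4) ->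
  forall i, P i.
Proof.
move=> P0 P1 P2 P3 P4 i; rewrite -(inord_val i).
by case: i => [[|[|[|[|[|i]]]]] Hi] //=.
Qed.

Lemma ordS5 :
  ((ordS (inord 0 : 'I_5) = inord 1) * (ordS (inord 1 : 'I_5) = inord 2) *
   (ordS (inord 2 : 'I_5) = inord 3) * (ordS (inord 3 : 'I_5) = inord 4) *
   (ordS (inord 4 : 'I_5) = inord 0))%type.
Proof. by do !split; apply: val_inj; rewrite /= !inordK. Qed.

Lemma ord_pred5 :
  ((ord_pred (inord 0 : 'I_5) = inord 4) * (ord_pred (inord 1 : 'I_5) = inord 0) *
   (ord_pred (inord 2 : 'I_5) = inord 1) * (ord_pred (inord 3 : 'I_5) = inord 2) *
   (ord_pred (inord 4 : 'I_5) = inord 3))%type.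
Proof. by do !split; apply: val_inj; rewrite /= !inordK. Qed.

Lemma big_ord5 (R : Type) (idx : R) (op : Monoid.law idx) (F : 'I_5 -> R) :
  \big[op/idx]_i F i =
  op (F (inord 0)) (op (F (inord 1)) (op (F (inord 2)) (op (F (inord 3)) (F (inord 4))))).
Proof.
rewrite !big_ord_recl big_ord0 Monoid.mulm1.
by do ![congr (op _ _)]; congr F; apply: val_inj; rewrite /= inordK.
Qed.

(** Such [i] and [j] are equal or at distance two. *)
Lemma C5_nonadj i j : ~~ C5 i j ->
  exists2 k, k \in [:: ord_pred i; ordS i] & k \in [:: ord_pred j; ordS j].
Proof.
rewrite /= /C5_rel; elim/ord5_ind: i; elim/ord5_ind: j;
rewrite !(ordS5, ord_pred5) -!val_eqE /= !inordK //= => _;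
first [by exists (inord 0); rewrite !inE -!val_eqE /= !inordK
     | by exists (inord 1); rewrite !inE -!val_eqE /= !inordK
     | by exists (inord 2); rewrite !inE -!val_eqE /= !inordK
     | by exists (inord 3); rewrite !inE -!val_eqE /= !inordK
     | by exists (inord 4); rewrite !inE -!val_eqE /= !inordK].
Qed.

(** * The partition induced by a 5-cycle *)

Section FiveCycle.
Variables (T : finType) (G : sgraph T) (c : 'I_5 -> T).
Hypothesis tfG : triangle_free G.
Hypothesis cycle_c : forall i, G (c i) (c (ordS i)).

Let fits v i := G v (c (ord_pred i)) && G v (c (ordS i)).

(** These are the vertices adjacent to [c i] for at most one [i]: two such indices are never
    consecutive, so they are the two neighbours of some index. *)
Definition C5_junk : {set T} := [set v | [forall i, ~~ fits v i]].

(** Junk vertices land in part [ord0], so that the parts cover all of [T]. *)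
Definition C5_colour : {ffun T -> 'I_5} :=
  [ffun v => odflt ord0 [pick i | fits v i]].

Let colour_fits v : v \notin C5_junk -> fits v (C5_colour v).
Proof.
rewrite inE negb_forall ffunE => /existsP[i]; rewrite negbK => fi.
by case: pickP => [j //|/(_ i)]; rewrite fi.
Qed.

Let tfG_common u v w : G u v -> G u w -> ~~ G v w.
Proof.
move=> uv uw; apply/negP => vw; apply: (tfG (x := u) (y := v) (z := w)).
by split; rewrite // adj_sym.
Qed.

Let adj_cN v i : G v (c i) -> ~~ G v (c (ordS i)).
Proof.
by move=> vi; apply/negP => /(tfG_common vi); rewrite cycle_c.
Qed.

(** The indices of the neighbours of [v] are independent in [C5], so there are at most two, and at
    most one if [v] is junk. *)
Let adj_cycle_le v : (\sum_i G v (c i) + (v \in C5_junk) <= 2)%N.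
Proof.
rewrite inE; have jE : [forall i, ~~ fits v i] = \big[andb/true]_i ~~ fits v i.
  by rewrite big_andE.
rewrite {}jE !big_ord5 /= /fits !(ordS5, ord_pred5).
have adjb i : G v (c i) ==> ~~ G v (c (ordS i)) by apply/implyP/adj_cN.
move: (adjb (inord 0)) (adjb (inord 1)) (adjb (inord 2)) (adjb (inord 3)).
move: (adjb (inord 4)); rewrite !ordS5.
case: (G v (c (inord 0))); case: (G v (c (inord 1))); case: (G v (c (inord 2)));
case: (G v (c (inord 3))); case: (G v (c (inord 4))) => //=.
Qed.

Lemma sum_degree_cycle_le : (\sum_i degree G (c i) + #|C5_junk| <= 2 * #|T|)%N.
Proof.
rewrite (eq_bigr _ (fun i _ => degree_sum G (c i))) exchange_big /=.
have -> : #|C5_junk| = (\sum_v (v \in C5_junk))%N.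
  by rewrite -sum1_card big_mkcond; apply: eq_bigr => v _; case: ifP.
by rewrite -big_split mulnC -sum_nat_const; apply: leq_sum => v _.
Qed.

(** A non-junk neighbour of [c i] with colour [k] also sees [c (k - 1)] and [c (k + 1)]; as no two
    of its cycle neighbours are consecutive, [i] is [k - 1] or [k + 1]. *)
Lemma degree_cycle_le i :
  (degree G (c i) <= #|part C5_colour (ord_pred i)| + #|part C5_colour (ordS i)|
                     + #|C5_junk|)%N.
Proof.
apply: leq_trans (leq_trans (leq_card_setU _ _) (leq_add (leq_card_setU _ _) (leqnn _))).
apply/subset_leq_card/subsetP => v.
have [vJ _|/colour_fits/andP[]] := boolP (v \in C5_junk).
  by rewrite in_setU vJ orbT.
move=> a b; rewrite !in_setU !in_set adj_sym => d; apply/orP; left; move: a b d.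
elim/ord5_ind: (C5_colour v); elim/ord5_ind: i;
rewrite !(ordS5, ord_pred5) -!val_eqE /= !inordK //= => a b d;
by move: (adj_cN a) (adj_cN b) (adj_cN d); rewrite !ordS5 ?a ?b ?d.
Qed.

Lemma blowup_of_nonjunk x y :
  G x y -> x \notin C5_junk -> y \notin C5_junk -> blowup C5 C5_colour x y.
Proof.
move=> xy /colour_fits/andP[x1 x2] /colour_fits/andP[y1 y2].
apply: contraT => /C5_nonadj[k kx ky].
have xk : G x (c k) by move: kx; rewrite !inE => /orP[]/eqP->.
have yk : G y (c k) by move: ky; rewrite !inE => /orP[]/eqP->.
by have := tfG_common xy xk; rewrite yk.
Qed.

End FiveCycle.

(** * Approximation by the blow-up *)

Lemma degree_blowup_C5 (T : finType) (f : {ffun T -> 'I_5}) x :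
  (degree (blowup C5 f) x <= #|part f (ord_pred (f x))| + #|part f (ordS (f x))|)%N.
Proof.
apply: leq_trans (leq_card_setU _ _); apply/subset_leq_card/subsetP => y.
rewrite !inE /= /blowup_rel /= /C5_rel => /orP[/eqP-> | /eqP->].
  by rewrite eqxx orbT.
by rewrite ordSK eqxx.
Qed.

Lemma sum_card_part (T U : finType) (f : {ffun T -> U}) :
  (\sum_i #|part f i|)%N = #|T|.
Proof.
rewrite -sum1_card (partition_big f xpredT) //=.
by apply: eq_bigr => i _; rewrite sum1dep_card.
Qed.

Lemma C5_approx_of_cycle (R : realType) (gam del eps : R) (T : finType)
    (G : sgraph T) (c : 'I_5 -> T) :
    triangle_free G -> (forall i, G (c i) (c (ordS i))) ->
    (forall i, (2 / 5 - gam) * #|T|%:R <= (degree G (c i))%:R) ->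
    (1 / 5 - del) * #|T|%:R ^+ 2 <= #|edges G|%:R ->
    0 <= gam -> 18 * gam <= eps -> del + 22 * gam <= eps ->
  C5_approx eps G.
Proof.
move=> tfG cyc degc edG gam0 gam_eps del_eps.
set n : R := #|T|%:R in degc edG *.
have n0 : 0 <= n by rewrite ler0n.
pose f := C5_colour G c; pose p i : R := #|part f i|%:R.
pose j : R := #|C5_junk G c|%:R; pose d i : R := (degree G (c i))%:R.
have degd i : 2 / 5 * n - gam * n <= d i by rewrite -mulrBl; apply: degc.
have degp i : d i <= p (ord_pred i) + p (ordS i) + j.
  by rewrite -!natrD ler_nat degree_cycle_le.
have sumd : \sum_i d i + j <= 2 * n.
  by rewrite -natr_sum -natrD -natrM ler_nat sum_degree_cycle_le.
have sump : \sum_i p i = n by rewrite -natr_sum sum_card_part.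
have j_le : j <= 5 * (gam * n).
  move: (degd (inord 0)) (degd (inord 1)) (degd (inord 2)) (degd (inord 3)).
  by move: (degd (inord 4)) sumd; rewrite !big_ord5 /=; lra.
(* The four parts other than [i] split into two pairs at distance two, each of size at least
   [2n/5 - 6 gam n]; this gives the upper bound. The lower bound follows from one pair containing
   [i] and the upper bound for its partner. *)
have p_bounds i : n / 5 - 18 * (gam * n) <= p i <= n / 5 + 12 * (gam * n).
  have pp k : 2 / 5 * n - 6 * (gam * n) <= p (ord_pred k) + p (ordS k).
    by move: (degd k) (degp k) j_le; lra.
  move: (pp (inord 0)) (pp (inord 1)) (pp (inord 2)) (pp (inord 3)).
  move: (pp (inord 4)) sump; rewrite !big_ord5 /= !(ordS5, ord_pred5).
  by elim/ord5_ind: i => *; apply/andP; split; lra.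
have gn : 18 * (gam * n) <= eps * n by rewrite mulrA ler_wpM2r.
have gn0 : 0 <= gam * n by rewrite mulr_ge0.
exists f; split=> [i|].
  rewrite ler_norml -/n -/(p i); case/andP: (p_bounds i) => ? ?.
  by apply/andP; split; lra.
have edH : 2 * #|edges (blowup C5 f)|%:R <= (2 / 5 * n + 24 * (gam * n)) * n.
  apply: (@le_trans _ _ (\sum_x degree (blowup C5 f) x)%:R).
    by rewrite -natrM ler_nat double_card_edges_le.
  rewrite natr_sum mulr_natr -sumr_const; apply: ler_sum => x _.
  apply: (@le_trans _ _ (p (ord_pred (f x)) + p (ordS (f x)))).
    by rewrite -natrD ler_nat degree_blowup_C5.
  by case/andP: (p_bounds (ord_pred (f x))); case/andP: (p_bounds (ordS (f x))); lra.
(* Of the error [22 gam n^2], the excess of the blow-up over [n^2 / 5] edges contributes 12 and the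
   edges at junk vertices 2 * 5. *)
have := card_symdiff_edges (blowup_of_nonjunk tfG (c := c)).
rewrite -/f -(ler_nat R) !natrD !natrM -/n -/j => sd.
have jn : j * n <= 5 * (gam * n) * n by rewrite ler_wpM2r.
have en : (del + 22 * gam) * n ^+ 2 <= eps * n ^+ 2 by rewrite ler_wpM2r ?exprn_ge0.
move: edG sd edH jn en; rewrite expr2; lra.
Qed.

(** * Low degrees and the final case distinction *)

Lemma card_low_degree_le (R : realType) (gam del : R) (T : finType) (G : sgraph T) :
    0 <= gam -> 0 <= del ->
    (1 / 5 - del) * #|T|%:R ^+ 2 <= #|edges G|%:R ->
    #|[set x : T | (2 / 5 + del) * #|T|%:R <= (degree G x)%:R]|%:R
      <= del * #|T|%:R ->
  gam * #|[set x : T | (degree G x)%:R < (2 / 5 - gam) * #|T|%:R]|%:R * #|T|%:R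
    <= 4 * del * #|T|%:R ^+ 2.
Proof.
set n : R := #|T|%:R; set big := [set x | _ <= _]; set low := [set x | _ < _].
move=> gam0 del0 edG big_le.
have n0 : 0 <= n by rewrite ler0n.
have gn : 0 <= gam * n by rewrite mulr_ge0.
have dn : 0 <= del * n by rewrite mulr_ge0.
have sum_ind (A : {set T}) (a : R) : \sum_x (x \in A)%:R * a = #|A|%:R * a.
  rewrite -mulr_suml -natr_sum -sum1_card; congr (_%:R * a).
  by rewrite [RHS]big_mkcond; apply: eq_bigr => x _; case: ifP.
(* Summed over [x], this bounds [2 |E(G)|], which is at least [(2/5 - 2 del) n^2]; the term
   [del n^2], the big vertices and this deficit add up to [4 del n^2]. *)
have deg_le x : (degree G x)%:R <=
    (2 / 5 + del) * n + (x \in big)%:R * n - (x \in low)%:R * (gam * n).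
  have deg_n : (degree G x)%:R <= n by rewrite ler_nat max_card.
  rewrite !inE; case: (lerP ((2 / 5 + del) * n)) => ?;
  by case: (ltrP _ ((2 / 5 - gam) * n)) => ? /=; lra.
have := double_card_edges_le G; rewrite -(ler_nat R) natrM natr_sum => edge_sum.
have := le_trans edge_sum (ler_sum _ (fun x _ => deg_le x)).
rewrite sumrB big_split /= sumr_const -mulr_natr -/n !sum_ind => ineq.
have bn : #|big|%:R * n <= del * n * n by rewrite ler_wpM2r.
move: edG ineq bn; rewrite expr2; lra.
Qed.

Theorem theorem5p2 (R : realType) (eps : R) (eps_gt0 : 0 < eps) :
  exists2 delta : R, 0 < delta &
    forall (T : finType) (G : sgraph T),
      triangle_free G ->
      (1 / 5 - delta) * #|T|%:R ^+ 2 <= #|edges G|%:R ->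
      [\/ C5_approx eps G,
          delta * #|T|%:R <=
            #|[set x : T | (2 / 5 + delta) * #|T|%:R <= (degree G x)%:R]|%:R
        | exists F : {set {set T}},
            [/\ F \subset edges G,
                #|F|%:R <= eps * #|T|%:R ^+ 2
              & bipartite (del_edges G F)]].
Proof.
(* The bound [eps / 30] gives [del + 22 gam <= eps]; the bound [1 / 60] gives [2/5 - 2 gam > 1/3],
   so that neighbourhoods within [S] exceed [n / 3]. *)
pose gam : R := Num.min (eps / 30) (1 / 60).
have gam0 : 0 < gam by rewrite lt_min; apply/andP; split; lra.
have gam_eps : gam <= eps / 30 by rewrite ge_min lexx.
have gam60 : gam <= 1 / 60 by rewrite ge_min lexx orbT.
(* Chosen so that [4 del / gam = gam]: at most [gam n] vertices lie outside [S]. *)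
pose del := gam * gam / 4.
have del0 : 0 < del by rewrite divr_gt0 ?mulr_gt0.
have del_gam : del <= gam by rewrite /del; nra.
exists del => // T G tfG edG; set n : R := #|T|%:R in edG *.
have [T0 | T_gt0] := posnP #|T|.
  by constructor 2; rewrite /n T0 mulr0 ler0n.
have [big_ge | /ltW big_le] := lerP (del * n) _; first by constructor 2.
have n_gt0 : 0 < n by rewrite ltr0n.
pose S := [set x : T | (2 / 5 - gam) * n <= (degree G x)%:R].
have low_le : #|~: S|%:R <= gam * n.
  have := card_low_degree_le (ltW gam0) (ltW del0) edG big_le.
  have -> : [set x | (degree G x)%:R < (2 / 5 - gam) * #|T|%:R] = ~: S.
    by apply/setP => x; rewrite !inE ltNge.
  rewrite -/n expr2 mulrA ler_pM2r // /del => h.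
  by rewrite -(ler_pM2l gam0); lra.
have [/existsP[w /forallP walk] | no_walk] := boolP [exists w : {ffun 'I_5 -> T},
    [forall i, (w i \in S) && G (w i) (w (ordS i))]].
  constructor 1; apply: (@C5_approx_of_cycle _ gam del _ _ _ w) => //; try lra.
    by move=> i; case/andP: (walk i).
  by move=> i; case/andP: (walk i); rewrite inE.
constructor 3; exists (incident_edges G (~: S)); split.
- by apply/subsetP => e; rewrite inE => /andP[].
- apply: (@le_trans _ _ (#|~: S|%:R * n)).
    by rewrite -natrM ler_nat card_incident_edges.
  by rewrite expr2 mulrA ler_pM2r //; nra.
have large x : x \in S -> (#|T| < 3 * #|nbhd G x :&: S|)%N.
  rewrite inE -(ltr_nat R) natrM -/n => degx.
  have : (degree G x)%:R <= #|nbhd G x :&: S|%:R + #|~: S|%:R :> R.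
    rewrite -natrD ler_nat /degree -(cardsID S [set y | G x y]) leq_add2l.
    by rewrite setDE subset_leq_card ?subsetIr.
  by nra.
have no_walk5 a b c d e : a \in S -> b \in S -> c \in S -> d \in S -> e \in S ->
    ~ [/\ G a b, G b c, G c d, G d e & G e a].
  move=> aS bS cS dS eS [ab bc cd de ea]; case/negP: no_walk; apply/existsP.
  exists [ffun i : 'I_5 => nth a [:: a; b; c; d; e] i]; apply/forallP.
  by elim/ord5_ind; rewrite !ordS5 !ffunE !inordK //=; apply/andP.
have [A A_colours] := two_colouring_of_no_walk5 tfG large no_walk5.
exists A => x y /andP[xy]; rewrite incident_edgesP // !inE negb_or !negbK.
by case/andP=> xS yS; apply: A_colours; rewrite ?inE.
Qed.
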